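(* Let $(X,G)$ be a $G$-metric space, let $m\ge 1$, let $X_1,\dots,X_m$ be nonempty subsets of $X$, and let $T:\bigcup_{i=1}^m X_i\to\bigcup_{i=1}^m X_i$ be a G-Mohseni cyclical operator with constant $\alpha\in(0,\frac12)$. Then for every $\epsilon>0$, $$\delta(F_G^{\epsilon}(T))\le \frac{2\epsilon(1+\alpha)}{1-2\alpha}.$$
   Context: A $G$-metric on a nonempty set $X$ is a function $G:X\times X\times X\to[0,\infty)$ such that: (G1) $G(x,y,z)=0$ if and only if $x=y=z$; (G2) $0<G(x,x,y)$ for all $x,y\in X$ with $x\neq y$; (G3) $G(x,x,y)\le G(x,y,z)$ for all $x,y,z\in X$ with $z\ne y$; (G4) $G$ is symmetric in its three variables (invariant under all permutations of its arguments); (G5) $G(x,y,z)\le G(x,a,a)+G(a,y,z)$ for all $x,y,z,a\in X$. The pair $(X,G)$ is called a $G$-metric space (completeness is not assumed). With the convention $X_{m+1}=X_1$, a map $T:\bigcup_{i=1}^m X_i\to\bigcup_{i=1}^m X_i$ is a cyclical operator if $T(X_i)\subseteq X_{i+1}$ for all $i=1,\dots,m$. A G-Mohseni cyclical operator with constant $\alpha\in(0,\frac12)$ is a cyclical operator $T$ such that for all $i\in\{1,\dots,m\}$, $x\in X_i$, $y\in X_{i+1}$, $$G(Tx,Ty,Ty)+G(Ty,Tx,Tx)\le \alpha\,[G(x,y,y)+G(y,x,x)+G(Tx,Ty,Ty)+G(Ty,Tx,Tx)].$$ For $\epsilon>0$, $F_G^{\epsilon}(T)$ denotes the set of $\epsilon$-fixed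 points of $T$, i.e. the set of $x\in\bigcup_{i=1}^m X_i$ with $G(x,Tx,Tx)+G(Tx,x,x)<\epsilon$. Its diameter is $\delta(F_G^{\epsilon}(T))=\sup\{G(x,y,z): x,y,z\in F_G^{\epsilon}(T)\}$. *)

(* Defs.v *)
From HB Require Import structures.
From mathcomp Require Import all_boot all_order all_algebra.
From mathcomp Require Import all_classical all_reals all_analysis.

Set Implicit Arguments.
Unset Strict Implicit.
Unset Printing Implicit Defensive.

Import Order.TTheory GRing.Theory Num.Theory.

Local Open Scope classical_set_scope.
Local Open Scope ring_scope.

Record is_G_metric (R : realType) (X : Type) (G : X -> X -> X -> R) : Prop := {
  G_metric_nonempty : [set: X] !=set0;
  G_metric_ge0 : forall x y z, 0 <= G x y z;
  G_metric_eq0 : forall x y z, G x y z = 0 <-> x = y /\ y = z;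
  G_metric_gt0 : forall x y, x <> y -> 0 < G x x y;
  G_metric_le : forall x y z, z <> y -> G x x y <= G x y z;
  G_metric_sym : forall x y z,
    [/\ G x y z = G x z y, G x y z = G y x z, G x y z = G y z x,
        G x y z = G z x y & G x y z = G z y x];
  G_metric_rectangle : forall x y z a, G x y z <= G x a a + G a y z }.

(* The m sets are indexed by 'I_m, and [ordS] is the cyclic successor, which
   realises the convention X_{m+1} = X_1. A map of the union to itself is a
   [{fun U >-> U}]: a function on X that sends U into U. Every notion below
   looks at its values on U only. *)
Definition cyclical_operator (X : Type) (m : nat) (Xs : 'I_m -> set X)
    (T : {fun \bigcup_i Xs i >-> \bigcup_i Xs i}) : Prop :=
  forall i, T @` Xs i `<=` Xs (ordS i).

Definition G_Mohseni_cyclical_operator (R : realType) (X : Type)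
    (G : X -> X -> X -> R) (m : nat) (Xs : 'I_m -> set X) (alpha : R)
    (T : {fun \bigcup_i Xs i >-> \bigcup_i Xs i}) : Prop :=
  [/\ 0 < alpha < 1 / 2, cyclical_operator T &
      forall i x y, Xs i x -> Xs (ordS i) y ->
        G (T x) (T y) (T y) + G (T y) (T x) (T x) <=
        alpha * (G x y y + G y x x
                 + G (T x) (T y) (T y) + G (T y) (T x) (T x))].

Definition eps_fixed_points (R : realType) (X : Type)
    (G : X -> X -> X -> R) (m : nat) (Xs : 'I_m -> set X)
    (T : {fun \bigcup_i Xs i >-> \bigcup_i Xs i}) (eps : R) : set X :=
  [set x | (\bigcup_i Xs i) x /\ G x (T x) (T x) + G (T x) x x < eps].

(* The supremum is taken in the extended reals: the real-valued [sup] is 0 on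
   unbounded sets, which would make upper bounds on it meaningless. The
   diameter of the empty set is -oo. *)
Definition G_diameter (R : realType) (X : Type) (G : X -> X -> X -> R)
    (A : set X) : \bar R :=
  ereal_sup [set r | exists x y z, [/\ A x, A y, A z & r = (G x y z)%:E]].

(* Main.v *)
Require Import Defs.
From HB Require Import structures.
From mathcomp Require Import all_boot all_order all_algebra.
From mathcomp Require Import all_classical all_reals all_analysis.
From mathcomp Require Import ring lra.

Set Implicit Arguments.
Unset Strict Implicit.
Unset Printing Implicit Defensive.

Import Order.TTheory GRing.Theory Num.Theory.
Import numFieldNormedType.Exports.

Local Open Scope classical_set_scope.
Local Open Scope ring_scope.

(** The symmetrization d(x, y) = G(x, y, y) + G(y, x, x) satisfies the triangle
    inequality, and in terms of d the Mohseni condition reads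
    d(Tx, Ty) <= k d(x, y) with k = alpha / (1 - alpha) < 1, for x and y in
    consecutive sets; an eps-fixed point x is one with d(x, Tx) < eps.

    Two eps-fixed points x and y need not lie in consecutive sets, so the
    contraction cannot be applied to them directly.  They are compared through
    their orbits instead.  Since x and Tx are in consecutive sets, the steps
    along the orbit of x shrink geometrically and the whole orbit stays within
    eps / (1 - k) of x ([cyclic_orbit_bound]).  Some iterate T^s y falls in the
    set that follows the one of x, so d(T^n x, T^(n+s) y) <= k^n d(x, T^s y)
    tends to 0.  Letting n grow in
      d(x, y) <= d(x, T^n x) + d(T^n x, T^(n+s) y) + d(T^(n+s) y, y)
    gives d(x, y) <= 2 eps / (1 - k) = 2 eps (1 - alpha) / (1 - 2 alpha)
    ([cyclic_eps_fixed_dist]).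

    Finally G(x, y, z) is at most the mean of the three pairwise values of d
    ([G_le_mean_dist]), so the same bound holds for G, and it is below the
    announced one because 1 - alpha <= 1 + alpha. *)

(** * Cyclic contractions for a symmetric distance *)

Lemma iter_ordS_val (m : nat) (i : 'I_m) (s : nat) :
  iter s (@ordS m) i = ((i + s) %% m)%N :> nat.
Proof.
elim: s => [|s IH]; first by rewrite addn0 modn_small.
by rewrite iterS /= IH -addn1 modnDml addn1 addnS.
Qed.

Lemma iter_ordS_transitive (m : nat) (i j : 'I_m) :
  exists s, iter s (@ordS m) j = i.
Proof.
(* [m - j] steps lead from [j] round to 0, and [i] more lead to [i]. *)
exists (m - j + i)%N; apply: val_inj; rewrite /= iter_ordS_val.
by rewrite addnA subnKC ?modnDl ?modn_small // ltnW.
Qed.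

Lemma cyclic_iter (X : Type) (m : nat) (Xs : 'I_m -> set X) (T : X -> X)
    (cyc : forall i x, Xs i x -> Xs (ordS i) (T x)) (n : nat) i x :
  Xs i x -> Xs (iter n (@ordS m) i) (iter n T x).
Proof. by move=> xi; elim: n => //= n IH; exact: cyc. Qed.

Lemma cyclic_contraction_iter (R : realType) (X : Type) (d : X -> X -> R)
    (m : nat) (Xs : 'I_m -> set X) (T : X -> X) (k : R) (k0 : 0 <= k)
    (cyc : forall i x, Xs i x -> Xs (ordS i) (T x))
    (ctr : forall i x y, Xs i x -> Xs (ordS i) y ->
       d (T x) (T y) <= k * d x y) (n : nat) i x y :
  Xs i x -> Xs (ordS i) y -> d (iter n T x) (iter n T y) <= k ^+ n * d x y.
Proof.
move=> xi yi; elim: n => [|n IH]; first by rewrite expr0 mul1r.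
have xn := cyclic_iter cyc n xi.
have yn : Xs (ordS (iter n (@ordS m) i)) (iter n T y).
  by rewrite -iterS iterSr; exact: cyclic_iter.
apply: (le_trans (ctr _ _ _ xn yn)).
by rewrite exprS -mulrA ler_wpM2l.
Qed.

(** The steps of the orbit are at most e, k e, k^2 e, ..., so that the partial
    sums of the geometric series bound the distance to the starting point. *)
Lemma cyclic_orbit_bound (R : realType) (X : Type) (d : X -> X -> R)
    (dxx : forall x, d x x = 0)
    (dtri : forall x y z, d x z <= d x y + d y z)
    (m : nat) (Xs : 'I_m -> set X) (T : X -> X) (k : R)
    (k0 : 0 <= k) (k1 : k < 1)
    (cyc : forall i x, Xs i x -> Xs (ordS i) (T x))
    (ctr : forall i x y, Xs i x -> Xs (ordS i) y ->
       d (T x) (T y) <= k * d x y) (e : R) (n : nat) i x :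
  Xs i x -> 0 <= e -> d x (T x) <= e -> d x (iter n T x) <= e / (1 - k).
Proof.
move=> xi e0 xe.
have k1' : 0 < 1 - k by rewrite subr_gt0.
(* 1 - k ^+ n is (1 - k) times the partial sum of the geometric series. *)
suff partial : (1 - k) * d x (iter n T x) <= (1 - k ^+ n) * e.
  rewrite ler_pdivlMr // mulrC (le_trans partial) //.
  by rewrite ler_piMl // lerBlDr lerDl exprn_ge0.
elim: n => [|n IH]; first by rewrite /= dxx expr0 mulr0 subrr mul0r.
have step : d (iter n T x) (iter n.+1 T x) <= k ^+ n * e.
  rewrite iterSr.
  apply: (le_trans (cyclic_contraction_iter k0 cyc ctr n xi (cyc _ _ xi))).
  by rewrite ler_wpM2l ?exprn_ge0.
apply: (le_trans (ler_wpM2l (ltW k1') (dtri x (iter n T x) _))).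
have := ler_wpM2l (ltW k1') step.
rewrite mulrDr exprS; lra.
Qed.

(** Points in sets that are not consecutive are compared through the tails of
    their orbits, which become arbitrarily close. *)
Lemma cyclic_eps_fixed_dist (R : realType) (X : Type) (d : X -> X -> R)
    (dxx : forall x, d x x = 0)
    (dsym : forall x y, d x y = d y x)
    (dtri : forall x y z, d x z <= d x y + d y z)
    (m : nat) (Xs : 'I_m -> set X) (T : X -> X) (k : R)
    (k0 : 0 <= k) (k1 : k < 1)
    (cyc : forall i x, Xs i x -> Xs (ordS i) (T x))
    (ctr : forall i x y, Xs i x -> Xs (ordS i) y ->
       d (T x) (T y) <= k * d x y) (e : R) i j x y :
  Xs i x -> Xs j y -> 0 <= e -> d x (T x) <= e -> d y (T y) <= e ->
  d x y <= 2 * (e / (1 - k)).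
Proof.
move=> xi yj e0 xe ye.
have [s sE] := iter_ordS_transitive (ordS i) j.
have ysi : Xs (ordS i) (iter s T y) by rewrite -sE; exact: cyclic_iter.
set C := d x (iter s T y); set B := e / (1 - k).
have tail n : d x y - 2 * B <= geometric C k n.
  have xB := cyclic_orbit_bound dxx dtri k0 k1 cyc ctr n xi e0 xe.
  have yB := cyclic_orbit_bound dxx dtri k0 k1 cyc ctr (n + s) yj e0 ye.
  have xy := cyclic_contraction_iter k0 cyc ctr n xi ysi.
  rewrite -iterD in xy.
  have t1 := dtri x (iter n T x) y.
  have t2 := dtri (iter n T x) (iter (n + s) T y) y.
  rewrite [d (iter _ T y) y]dsym in t2.
  rewrite /= [C * _]mulrC /B /C; lra.
have cvg0 : geometric C k @ \oo --> (0 : R).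
  by apply: cvg_geometric; rewrite ger0_norm.
rewrite -subr_le0 -(cvg_lim _ cvg0) //.
apply: limr_ge; first by apply: cvgP cvg0.
exact: nearW.
Qed.

(** * The symmetrized distance of a G-metric *)

Definition G_dist (R : realType) (X : Type) (G : X -> X -> X -> R) (x y : X) :=
  G x y y + G y x x.

Lemma G_distC (R : realType) (X : Type) (G : X -> X -> X -> R) x y :
  G_dist G x y = G_dist G y x.
Proof. exact: addrC. Qed.

Lemma G_dist_xx (R : realType) (X : Type) (G : X -> X -> X -> R)
    (hG : is_G_metric G) x : G_dist G x x = 0.
Proof.
have /(G_metric_eq0 hG) Gx0 : x = x /\ x = x by [].
by rewrite /G_dist Gx0 addr0.
Qed.

Lemma G_dist_triangle (R : realType) (X : Type) (G : X -> X -> X -> R)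
    (hG : is_G_metric G) x y z : G_dist G x z <= G_dist G x y + G_dist G y z.
Proof.
rewrite /G_dist.
have := G_metric_rectangle hG x z z y.
have := G_metric_rectangle hG z x x y.
lra.
Qed.

(** Routing through each of the three points in turn, as in
    G(x, y, z) <= G(x, y, y) + G(z, y, y), and adding the three inequalities
    uses each of the six values G(u, v, v) exactly once. *)
Lemma G_le_mean_dist (R : realType) (X : Type) (G : X -> X -> X -> R)
    (hG : is_G_metric G) x y z :
  G x y z <= (G_dist G x y + G_dist G y z + G_dist G x z) / 3.
Proof.
have via u v w : G u v w <= G u v v + G w v v.
  have := G_metric_rectangle hG u v w v.
  by have [_ _ -> _ _] := G_metric_sym hG w v v; case: (G_metric_sym hG v v w).
have hy := via x y z; have hx := via y x z; have hz := via x z y.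
have [xzy yxz _ _ _] := G_metric_sym hG x y z.
rewrite -xzy in hz; rewrite -yxz in hx; rewrite /G_dist; lra.
Qed.

(** Moving the terms of the image to the left turns the Mohseni condition into
    a contraction of ratio alpha / (1 - alpha). *)
Lemma G_Mohseni_contraction (R : realType) (X : Type) (G : X -> X -> X -> R)
    (m : nat) (Xs : 'I_m -> set X) (alpha : R)
    (T : {fun \bigcup_i Xs i >-> \bigcup_i Xs i})
    (hT : G_Mohseni_cyclical_operator G alpha T) i x y :
  Xs i x -> Xs (ordS i) y ->
  G_dist G (T x) (T y) <= alpha / (1 - alpha) * G_dist G x y.
Proof.
case: hT => /andP[a0 a1] _ ctr xi yi.
have a1' : 0 < 1 - alpha by lra.
rewrite mulrAC ler_pdivlMr // /G_dist.
have := ctr _ _ _ xi yi; lra.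
Qed.

Theorem theorem5p1 (R : realType) (X : Type) (G : X -> X -> X -> R)
    (hG : is_G_metric G) (m : nat) (hm : (1 <= m)%N) (Xs : 'I_m -> set X)
    (hXs : forall i, Xs i !=set0) (alpha : R)
    (T : {fun \bigcup_i Xs i >-> \bigcup_i Xs i})
    (hT : G_Mohseni_cyclical_operator G alpha T)
    (eps : R) (heps : 0 < eps) :
  (G_diameter G (eps_fixed_points G T eps)
     <= (2 * eps * (1 + alpha) / (1 - 2 * alpha))%:E)%E.
Proof.
have [/andP[a0 a1] cyc _] := hT.
have a1' : 0 < 1 - alpha by lra.
have a2' : 0 < 1 - 2 * alpha by lra.
have k0 : 0 <= alpha / (1 - alpha) by rewrite divr_ge0 // ltW.
have k1 : alpha / (1 - alpha) < 1 by rewrite ltr_pdivrMr //; lra.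
have cycT i x : Xs i x -> Xs (ordS i) (T x) by move=> xi; apply: cyc; exists x.
have dist x y : eps_fixed_points G T eps x -> eps_fixed_points G T eps y ->
    G_dist G x y <= 2 * eps * (1 + alpha) / (1 - 2 * alpha).
  move=> [[i _ xi] /ltW xe] [[j _ yj] /ltW ye].
  apply: (le_trans (cyclic_eps_fixed_dist (G_dist_xx hG) (G_distC G)
    (G_dist_triangle hG) k0 k1 cycT (G_Mohseni_contraction hT)
    xi yj (ltW heps) xe ye)).
  have -> : 2 * (eps / (1 - alpha / (1 - alpha)))
      = 2 * eps * (1 - alpha) / (1 - 2 * alpha).
    by field; rewrite !lt0r_neq0 //; lra.
  by rewrite ler_wpM2r ?invr_ge0 ?(ltW a2') // ler_wpM2l //; lra.
apply: ge_ereal_sup => _ [x [y [z [hx hy hz ->]]]].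
rewrite lee_fin (le_trans (G_le_mean_dist hG x y z)) //.
have := dist _ _ hx hy; have := dist _ _ hy hz; have := dist _ _ hx hz.
lra.
Qed.
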